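(* Let $G$ be a finite connected simple undirected graph with $N \ge 2$ vertices, and let $m$ be the minimum $k\ge 0$ such that $G$ has a $k$-Unbounded Hamiltonian Cycle. Let $H$ be the following weighted directed graph. For each vertex $v$ of $G$, $H$ has $3N$ vertices $v_{a_1},\dots,v_{a_N},v_{b_1},\dots,v_{b_N},v_{c_1},\dots,v_{c_N}$. The directed edges of $H$ are: (i) for every ordered pair $(v,w)$ of adjacent vertices of $G$, an edge from $v_i$ to $w_j$ for all $i \in \{c_1,\dots,c_N,a_1\}$ and all $j \in \{a_1,\dots,a_N,c_N\}$; (ii) for every vertex $v$ of $G$, edges in both directions between $v_{a_i}$ and $v_{b_i}$ and between $v_{b_i}$ and $v_{c_i}$ for $1 \le i \le N$, and edges in both directions between $v_{a_i}$ and $v_{c_{i-1}}$ for $2 \le i \le N$. For each vertex $v$ of $G$, choose exactly one ''downward'' directed edge, that is, one edge of the form $v_{a_i} \to v_{b_i}$ or $v_{b_i} \to v_{c_i}$ with $1\le i\le N$, and give it weight $1$; all other edges of $H$ have weight $0$. Then $H$ has a directed Hamiltonian cycle, and the minimum total weight of a directed Hamiltonian cycle of $H$ (i.e. the optimal value of the Asymmetric Traveling Salesman Problem on $H$) equals $m$.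
   Context: A path here means a finite walk, i.e. a finite sequence of vertices $(x_1,\dots,x_\ell)$ with consecutive vertices adjacent; vertices and edges may repeat. A vertex is bounded in such a path if it appears exactly once in the sequence and unbounded if it appears more than once. A $k$-Unbounded Hamiltonian Path is a path in which every vertex of the graph appears and exactly $k$ vertices are unbounded. A $k$-Unbounded Hamiltonian Cycle is a $k$-Unbounded Hamiltonian Path whose first and last vertices $x_1$, $x_\ell$ are adjacent. *)

(* Defs.v *)
From HB Require Import structures.
From mathcomp Require Import all_boot.

Set Implicit Arguments.
Unset Strict Implicit.
Unset Printing Implicit Defensive.

Definition is_minimum (P : nat -> Prop) (m : nat) : Prop :=
  P m /\ forall k, P k -> m <= k.

(* A finite simple undirected graph is a symmetric irreflexive relation [e] on
   its finite type of vertices. *)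
Definition connected (T : finType) (e : rel T) : Prop :=
  forall x y : T, connect e x y.

Definition unbounded (T : eqType) (s : seq T) (v : T) : bool :=
  1 < count_mem v s.

Definition unbounded_ham_path (T : finType) (e : rel T) (k : nat) (s : seq T) :
    bool :=
  [&& sorted e s, [forall v, v \in s] & #|[set v | unbounded s v]| == k].

Definition ends_adjacent (T : finType) (e : rel T) (s : seq T) : bool :=
  if s is x :: p then e x (last x p) else false.

Definition unbounded_ham_cycle (T : finType) (e : rel T) (k : nat)
    (s : seq T) : bool :=
  unbounded_ham_path e k s && ends_adjacent e s.

Definition ham_cycle (V : finType) (E : rel V) (c : seq V) : bool :=
  [&& cycle E c, uniq c & [forall x, x \in c]].

(* As [next] looks up the first occurrence, this is meaningful on
   duplicate-free [c]; the sum includes the closing edge. *)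
Definition cycle_weight (V : eqType) (w : V -> V -> nat) (c : seq V) : nat :=
  \sum_(x <- c) w x (next c x).

(* Labels are numbered from 0: [La i], [Lb i], [Lc i] stand for a_{i+1},
   b_{i+1}, c_{i+1}. *)
Inductive label (n : nat) : Type :=
  | La of 'I_n
  | Lb of 'I_n
  | Lc of 'I_n.

Definition label_code n (l : label n) : 'I_n + 'I_n + 'I_n :=
  match l with
  | La i => inl (inl i)
  | Lb i => inl (inr i)
  | Lc i => inr i
  end.

Definition label_decode n (s : 'I_n + 'I_n + 'I_n) : label n :=
  match s with
  | inl (inl i) => La i
  | inl (inr i) => Lb i
  | inr i => Lc i
  end.

Lemma label_codeK n : cancel (@label_code n) (@label_decode n).
Proof. by case. Qed.

HB.instance Definition _ n := Finite.copy (label n) (can_type (@label_codeK n)).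

Definition tsp_vertex (T : finType) : finType := (T * label #|T|)%type.

(* {c_1, ..., c_n, a_1} *)
Definition exit_label n (l : label n) : bool :=
  match l with
  | La i => i == 0 :> nat
  | Lb _ => false
  | Lc _ => true
  end.

(* {a_1, ..., a_n, c_n} *)
Definition entry_label n (l : label n) : bool :=
  match l with
  | La _ => true
  | Lb _ => false
  | Lc i => i.+1 == n
  end.

(* a_i -> b_i and b_i -> c_i *)
Definition down_label n (l l' : label n) : bool :=
  match l, l' with
  | La i, Lb j => i == j
  | Lb i, Lc j => i == j
  | _, _ => false
  end.

(* c_{i-1} -> a_i *)
Definition link_label n (l l' : label n) : bool :=
  match l, l' with
  | Lc i, La j => i.+1 == j :> nat
  | _, _ => false
  end.

Definition tsp_edge (T : finType) (e : rel T) : rel (tsp_vertex T) :=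
  fun x y =>
    [&& e x.1 y.1, exit_label x.2 & entry_label y.2]
    || (x.1 == y.1) &&
       [|| down_label x.2 y.2, down_label y.2 x.2,
           link_label x.2 y.2 | link_label y.2 x.2].

Definition downward_edge (T : finType) (v : T)
    (xy : tsp_vertex T * tsp_vertex T) : bool :=
  [&& xy.1.1 == v, xy.2.1 == v & down_label xy.1.2 xy.2.2].

(* [d v] is the edge chosen for [v]. *)
Definition tsp_weight (T : finType) (d : T -> tsp_vertex T * tsp_vertex T)
    (x y : tsp_vertex T) : nat :=
  if [exists v, d v == (x, y)] then 1 else 0.

(* Main.v *)
Require Import Defs.
From Stdlib Require Import Classical.
From mathcomp Require Import all_boot zify.

(* In a Hamiltonian cycle of H every b_i is crossed either downwards
   (a_i, b_i, c_i) or upwards (c_i, b_i, a_i).  An upward crossing of one triple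
   of v forces upward crossings of the neighbouring triples, hence of all of
   them, and then v is visited in a single block from c_N to a_1.  So the chosen
   edge of v is avoided exactly when v is crossed upwards, and projecting the
   cycle to G gives a closed walk in which such a v is bounded.

   Conversely, a closed walk of G can be shortened until it visits each vertex
   at most N times, without making a bounded vertex unbounded: among the
   excursions between consecutive visits of v, one that discovers no new vertex
   can be deleted.  Such a walk lifts to H by crossing bounded vertices upwards
   in one visit and spreading the N downward triples of each other vertex over its
   visits, the last visit taking all the remaining triples. *)

Set Implicit Arguments.
Unset Strict Implicit.
Unset Printing Implicit Defensive.

(** * Least elements of predicates on the naturals *)

Lemma ex_is_minimum (P : nat -> Prop) :
  (exists k, P k) -> exists m, is_minimum P m.
Proof.
move=> [k]; elim/ltn_ind: k => k IHk Pk.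
have [[j ltjk Pj]|nlt] := classic (exists2 j, j < k & P j); first exact: IHk Pj.
exists k; split=> // j Pj; rewrite leqNgt; apply/negP=> ltjk.
by apply: nlt; exists j.
Qed.

(** * Closed walks of G and their shortening *)

Section ClosedWalks.

Variables (T : finType) (e : rel T).

(** The closing edge of [cycle] runs from last to first, that of [ends_adjacent] from first to last;
    symmetry identifies them. *)
Lemma ham_cycle_of_closed_walk (e_sym : symmetric e) s :
    s != [::] -> cycle e s -> (forall v, v \in s) ->
  unbounded_ham_cycle e #|[set v | unbounded s v]| s.
Proof.
case: s => // x p _ /=; rewrite rcons_path => /andP[xp px] s_all.
by rewrite /unbounded_ham_cycle /unbounded_ham_path /= xp eqxx andbT e_sym px
  andbT; apply/forallP.
Qed.

Lemma closed_walk_of_ham_cycle (e_sym : symmetric e) k s :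
    unbounded_ham_cycle e k s ->
  [/\ cycle e s, forall v, v \in s & #|[set v | unbounded s v]| = k].
Proof.
move=> /andP[/and3P[s_walk /forallP s_all /eqP kE] s_ends]; split=> //.
case: s s_walk s_ends {s_all kE} => //= x p xp px.
by rewrite rcons_path xp e_sym.
Qed.

Lemma connected_walk_cover (e_conn : connected e) x (vs : seq T) :
  exists2 p, path e x p & {subset vs <= x :: p}.
Proof.
elim/last_ind: vs => [|vs v [p xp vsp]]; first by exists [::].
have /connectP[q lq vE] := e_conn (last x p) v.
exists (p ++ q) => [|u]; first by rewrite cat_path xp.
rewrite mem_rcons inE => /predU1P[->|/vsp up].
  by rewrite vE -last_cat mem_last.
by rewrite -cat_cons mem_cat up.
Qed.

Lemma connected_neighbour (e_conn : connected e) (T_ge2 : 2 <= #|T|) x :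
  exists y, e x y.
Proof.
have /card_gt0P[y] : 0 < #|predC1 x|.
  by rewrite cardC1; case: #|T| T_ge2 => [|[]].
rewrite inE /= => y_x; have /connectP[[|z p] /= xp yE] := e_conn x y.
  by rewrite yE eqxx in y_x.
by exists z; case/andP: xp.
Qed.

(** A walk from [x] covering all vertices is prolonged to a neighbour [y] of [x], so that it closes
    up. *)
Lemma ex_unbounded_ham_cycle (e_sym : symmetric e) (e_conn : connected e)
    (T_ge2 : 2 <= #|T|) :
  exists k s, unbounded_ham_cycle e k s.
Proof.
have /card_gt0P[x _] : 0 < #|T| by apply: leq_trans T_ge2.
have [y xy] := connected_neighbour e_conn T_ge2 x.
have [p xp p_all] := connected_walk_cover e_conn x (enum T).
have /connectP[q lq yE] := e_conn (last x p) y.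
exists #|[set v | unbounded (x :: p ++ q) v]|, (x :: p ++ q).
apply: ham_cycle_of_closed_walk => //= [|v].
  by rewrite rcons_path cat_path xp lq last_cat -yE e_sym.
by rewrite -cat_cons mem_cat p_all ?mem_enum.
Qed.

(* Each return to [v] either discovers a new vertex or closes a superfluous
   excursion [v :: w]. *)
Lemma superfluous_excursion (v : T) (q p : seq T) :
    v \in q -> #|q ++ v :: p| < #|q| + count_mem v (v :: p) ->
  exists q1 w p1, [/\ q ++ v :: p = q1 ++ v :: w ++ p1, v \in q1,
    {subset w <= q1} & (p1 == [::]) || (head v p1 == v)].
Proof.
have [n] := ubnP (size p); elim: n => // n IHn in p q *; rewrite ltnS => le_p_n.
have card_new w : ~~ all (mem q) w -> #|q| < #|q ++ v :: w|.
  case/allPn=> u uw uq; apply: proper_card; apply/properP; split.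
    by apply/subsetP=> z zq; rewrite mem_cat zq.
  by exists u; rewrite // mem_cat inE uw !orbT.
(* If [v] does not return, its count is 1, and the bound says that [p] brings no vertex outside
   [q]. *)
move=> vq lt_card; have [vp|vp] := boolP (v \in p); last first.
  exists q, p, [::]; rewrite cats0 eqxx; split=> //; apply/allP.
  apply/negPn/negP=> /card_new; move: lt_card.
  by rewrite /= eqxx (count_memPn vp); lia.
have vE := drop_index vp; rewrite -[p](cat_take_drop (index v p)) vE.
have := in_take_leq v (index_size v p); rewrite ltnn.
set w := take _ p; set p2 := drop _ p => /negbT vw.
have pE : p = w ++ v :: p2 by rewrite -vE cat_take_drop.
rewrite {vE}pE in le_p_n lt_card *.
have [wq|/card_new wq] := boolP (all (mem q) w).
  by exists q, w, (v :: p2); rewrite /= eqxx; split=> //; apply/allP.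
(* Moving [v :: w] into the prefix removes one visit of [v] and adds at least one distinct vertex,
   so the strict inequality survives. *)
have [||| q1 [w1 [p1 [sE vq1 w1q1 p1v]]]] := IHn p2 (q ++ v :: w).
- by move: le_p_n; rewrite size_cat /=; lia.
- by rewrite mem_cat vq.
- move: lt_card; rewrite -catA /= count_cat /= eqxx (count_memPn vw).
  by move/leq_trans; apply; rewrite add0n addnA addn1 leq_add2r.
by exists q1, w1, p1; split=> //; rewrite -sE -catA.
Qed.

Lemma shorten_closed_walk v s :
    cycle e s -> (forall u, u \in s) -> #|T| < count_mem v s ->
  exists s', [/\ cycle e s', forall u, u \in s', size s' < size s &
    forall u, count_mem u s' <= count_mem u s].
Proof.
wlog [p ->] : s / exists p, s = v :: p => [rotated ss s_all lt_v|].
  have [i p sE] := rot_to (s_all v).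
  have countE u : count_mem u (v :: p) = count_mem u s.
    by rewrite -sE; apply/permP; rewrite perm_rot.
  have [||||s' [ss' s'_all lt_s' le_s']] := rotated (v :: p).
  - by exists p.
  - by rewrite -sE rot_cycle.
  - by move=> u; rewrite -sE mem_rot.
  - by rewrite countE.
  exists s'; split=> // [|u]; last by rewrite -countE.
  by rewrite -(size_rot i s) sE.
move=> vp p_all; rewrite /= eqxx add1n ltnS => le_v.
have T_gt0 : 0 < #|T| by apply/card_gt0P; exists v.
have v_p : v \in p by rewrite -has_pred1 has_count (leq_trans T_gt0).
have vE := drop_index v_p.
have := in_take_leq v (index_size v p); rewrite ltnn.
move: (cat_take_drop (index v p) p); rewrite vE.
move: (take _ p) (drop _ p) => w p2 pE /negbT vw.
have [||q1 [w1 [p1 [sE vq1 w1q1 p1v]]]] := @superfluous_excursion v (v :: w) p2.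
- exact: mem_head.
- apply: leq_ltn_trans (max_card _) _; apply: leq_ltn_trans le_v _.
  rewrite -pE count_cat (count_memPn vw) -add1n leq_add2r.
  by apply/card_gt0P; exists v; apply: mem_head.
case: q1 vq1 w1q1 sE => // v' q1 + + [vv']; rewrite pE -{}vv' => vq1 w1q1 sE.
rewrite {}sE in vp p_all *; exists (v :: q1 ++ p1); split.
(* Whether [p1] is empty or starts with [v], the vertex following the cut is [v], so the edge that
   entered the deleted excursion is reused. *)
- have [r p1E] : exists r, rcons p1 v = v :: r.
    by case: p1 p1v {vp p_all} => [|z p1] /= => [|/eqP->];
       [exists [::] | exists (rcons p1 v)].
  move: vp; rewrite /= !rcons_cat /= rcons_cat p1E !cat_path /= cat_path /=.
  by case/and5P=> -> -> _ _ ->.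
- move=> u; have : u \in (v :: q1) ++ v :: w1 ++ p1 := p_all u.
  rewrite -[v :: q1 ++ p1]cat_cons !mem_cat [u \in v :: w1 ++ p1]inE mem_cat.
  by case/or4P=> [->|/eqP->|/w1q1->|->]; rewrite ?vq1 ?orbT.
- by rewrite /= !size_cat /= size_cat; lia.
- by move=> u; rewrite /= !count_cat /= count_cat; lia.
Qed.

Lemma closed_walk_few_visits s :
    cycle e s -> (forall u, u \in s) ->
  exists s', [/\ cycle e s', forall u, u \in s',
    forall u, count_mem u s' <= #|T| &
    forall u, count_mem u s' <= count_mem u s].
Proof.
have [n] := ubnP (size s); elim: n => // n IHn in s *.
rewrite ltnS => le_s ss s_all.
have [/forallP few|/forallPn[v]] := boolP [forall u, count_mem u s <= #|T|].
  by exists s.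
rewrite -ltnNge => lt_v.
have [s1 [ss1 s1_all lt_s1 le1]] := shorten_closed_walk ss s_all lt_v.
have [|s2 [ss2 s2_all few le2]] := IHn s1 _ ss1 s1_all.
  exact: leq_trans lt_s1 le_s.
by exists s2; split=> // u; apply: leq_trans (le1 u).
Qed.

End ClosedWalks.

(** * Successors in a cycle, and entries into fibres *)

Lemma next_next_neq (V : eqType) (c : seq V) x :
  uniq c -> 2 < size c -> x \in c -> next c (next c x) != x.
Proof.
move=> c_uniq c_size xc; have [i p cE] := rot_to xc.
rewrite -(next_rot i c_uniq) -(next_rot i c_uniq).
move: c_uniq c_size; rewrite -(rot_uniq i) -(size_rot i) cE.
case: p {cE} => [|y [|z p]] //=; rewrite !inE !negb_or.
case/and3P=> /and3P[xy xz _] _ _ _.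
by rewrite !eqxx [y == x]eq_sym (negPf xy) [z == x]eq_sym.
Qed.

Section Entries.

Variables (T : eqType) (L : Type).
Implicit Types (x y : T * L) (p : seq (T * L)).

(* The vertices of the walk [p] reached from outside of their own fibre. *)
Fixpoint entries x p : seq (T * L) :=
  if p is y :: p' then
    if x.1 == y.1 then entries y p' else y :: entries y p'
  else [::].

Lemma entries_path (e : rel T) x p :
    path (fun y z => (y.1 == z.1) || e y.1 z.1) x p ->
  path e x.1 (map fst (entries x p)).
Proof.
elim: p x => //= y p IHp x /andP[+ /IHp yp].
by case: eqP => [->|_] //= ->.
Qed.

Lemma last_entries x p : last x.1 (map fst (entries x p)) = (last x p).1.
Proof. by elim: p x => //= y p IHp x; case: eqP => [->|_] /=. Qed.

End Entries.

Lemma entries_subseq (T L : eqType) (x : T * L) p : subseq (entries x p) p.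
Proof.
elim: p x => //= y p IHp x; case: ifP => _; last by rewrite eqxx.
by apply: subseq_trans (IHp y) (subseq_cons _ _).
Qed.

Lemma mem_entries (T L : eqType) (x y : T * L) p :
  y \in p -> y.1 \in x.1 :: map fst (entries x p).
Proof.
elim: p x => //= z p IHp x; rewrite inE => /predU1P[->|/(IHp z)].
  by rewrite [x.1 == z.1]eq_sym; case: eqP => //= _; rewrite mem_head.
rewrite [x.1 == z.1]eq_sym inE; case: (z.1 =P x.1) => [->//|_] /= zp.
by rewrite inE zp orbT.
Qed.

Lemma entries_pred (T L : eqType) (f : T * L -> T * L) (x y : T * L) p :
  fpath f x p -> y \in entries x p -> exists2 z, z.1 != y.1 & f z = y.
Proof.
elim: p x => //= z p IHp x /andP[/eqP fx zp]; case: (boolP (_ == _)) => xz.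
  exact: IHp zp.
by rewrite inE => /predU1P[->|]; [exists x | apply: IHp zp].
Qed.

(** * Hamiltonian cycles of H and their projection to G *)

Section HamiltonianCycles.

Variables (T : finType) (e : rel T).
Variable c : seq (tsp_vertex T).
Hypothesis c_ham : ham_cycle (tsp_edge e) c.

Notation V := (tsp_vertex T).
Notation nx := (next c).
Notation a v i := ((v, La i) : V).
Notation b v i := ((v, Lb i) : V).
Notation c' v i := ((v, Lc i) : V).

Let c_cycle : cycle (tsp_edge e) c. Proof. by case/and3P: c_ham. Qed.
Let c_uniq : uniq c. Proof. by case/and3P: c_ham. Qed.
Let c_all x : x \in c. Proof. by case/and3P: c_ham => _ _ /forallP. Qed.

Lemma ham_next_edge x : tsp_edge e x (nx x).
Proof. exact: next_cycle. Qed.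

Lemma ham_next_inj : injective nx.
Proof. exact: can_inj (prev_next c_uniq). Qed.

Lemma ham_pred y : exists2 x, nx x = y & tsp_edge e x y.
Proof.
exists (prev c y); first exact: next_prev.
by rewrite -{2}(next_prev c_uniq y) ham_next_edge.
Qed.

(** One triple already makes the cycle longer than 2, so it never turns straight back. *)
Lemma ham_next2 (v : T) (i : 'I_#|T|) x : nx (nx x) <> x.
Proof.
apply/eqP/next_next_neq => //.
apply: (@uniq_leq_size V [:: a v i; b v i; c' v i]) => [|y _]; last first.
  exact: c_all.
by rewrite /= !inE !xpair_eqE !andbF.
Qed.

Lemma tsp_edge_b v i y : tsp_edge e (b v i) y -> y = a v i \/ y = c' v i.
Proof.
case: y => u [j|j|j]; rewrite /tsp_edge /= ?andbF ?orbF //=.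
  by case/andP=> /eqP<- /eqP->; left.
by case/andP=> /eqP<- /eqP->; right.
Qed.

Lemma tsp_edge_to_b v i x : tsp_edge e x (b v i) -> x = a v i \/ x = c' v i.
Proof.
case: x => u [j|j|j]; rewrite /tsp_edge /= ?andbF ?orbF //=.
  by case/andP=> /eqP<- /eqP->; left.
by case/andP=> /eqP<- /eqP->; right.
Qed.

Lemma tsp_edge_a v (i : 'I_#|T|) y : 0 < i -> tsp_edge e (a v i) y ->
  y = b v i \/ exists2 j : 'I_#|T|, j.+1 = i & y = c' v j.
Proof.
move=> i_gt0; rewrite /tsp_edge /= eqn0Ngt i_gt0 /= andbF.
case: y => u [j|j|j] /=; rewrite ?andbF ?orbF //.
  by case/andP=> /eqP<- /eqP->; left.
by case/andP=> /eqP<- /eqP; right; exists j.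
Qed.

Lemma tsp_edge_to_c v (i : 'I_#|T|) x : i.+1 != #|T| -> tsp_edge e x (c' v i) ->
  x = b v i \/ exists2 j : 'I_#|T|, i.+1 = j & x = a v j.
Proof.
move=> /negPf i_lt; rewrite /tsp_edge /= i_lt !andbF /=.
case: x => u [j|j|j] /=; rewrite ?andbF ?orbF //.
  by case/andP=> /eqP<- /eqP; right; exists j.
by case/andP=> /eqP<- /eqP->; left.
Qed.

Definition upward v i := nx (c' v i) = b v i /\ nx (b v i) = a v i.

(** The only neighbours of [b_i] are [a_i] and [c_i]: if it is not reached from [a_i], it is reached
    from [c_i] and cannot turn back there. *)
Lemma upward_of_not_ab v i : nx (a v i) <> b v i -> upward v i.
Proof.
move=> not_ab; have [x nx_x /tsp_edge_to_b] := ham_pred (b v i).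
case=> xE; rewrite {}xE // in nx_x; split=> //.
have [//|nb] := tsp_edge_b (ham_next_edge (b v i)).
by case: (@ham_next2 v i (c' v i)); rewrite nx_x.
Qed.

Lemma upward_of_not_bc v i : nx (b v i) <> c' v i -> upward v i.
Proof.
move=> not_bc; have [ba|//] := tsp_edge_b (ham_next_edge (b v i)).
have [x nx_x /tsp_edge_to_b] := ham_pred (b v i).
case=> xE; rewrite {}xE // in nx_x.
by case: (@ham_next2 v i (a v i)); rewrite nx_x.
Qed.

(** Below the top index, [c_i] can be reached only from [b_i], which goes to [a_i], or from [a_j].
    So [a_j] goes to [c_i] and not to [b_j]. *)
Lemma upward_succ v (i j : 'I_#|T|) : i.+1 = j -> upward v i -> upward v j.
Proof.
move=> ij [_ ba]; apply: upward_of_not_ab => ab.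
have i_lt : i.+1 != #|T| by rewrite ij neq_ltn ltn_ord.
have [x nx_x /(tsp_edge_to_c i_lt)[xE|[k ik xE]]] := ham_pred (c' v i).
  by rewrite xE ba in nx_x.
have kj : k = j by apply: val_inj; rewrite /= -ik.
by rewrite xE kj ab in nx_x.
Qed.

(** [a_j] must go to [c_i], since going to [b_j] would turn back; by injectivity of [next], [b_i]
    does not go to [c_i]. *)
Lemma upward_pred v (i j : 'I_#|T|) : i.+1 = j -> upward v j -> upward v i.
Proof.
move=> ij [cb ba]; apply: upward_of_not_bc => bc.
have j_gt0 : 0 < j by rewrite -ij.
case: (tsp_edge_a j_gt0 (ham_next_edge (a v j))) => [ab|[k kj ac]].
  by case: (@ham_next2 v j (b v j)); rewrite ba.
have ki : k = i by apply: val_inj; apply: succn_inj; rewrite kj.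
by rewrite ki -bc in ac; have := ham_next_inj ac.
Qed.

Lemma upward_all v i j : upward v i -> upward v j.
Proof.
(* Descend from [i] to index 0, then climb to [j]; [P n] is vacuous for [n] at least N. *)
move=> up_i; pose P n := forall k : 'I_#|T|, k = n :> nat -> upward v k.
have P_pred n : n.+1 < #|T| -> P n.+1 -> P n.
  move=> lt_n Pn k kn; apply: (@upward_pred v k (Ordinal lt_n)); last exact: Pn.
  by rewrite kn.
have P0 : P 0.
  have Pi : P i by move=> k /val_inj->.
  elim: (val i) (ltn_ord i) Pi => [|n IHn] // lt_n /(P_pred _ lt_n).
  exact/IHn/ltnW.
suff /(_ j) : forall n, P n by apply.
elim=> [//|n IHn] k kn; have lt_n : n < #|T| by rewrite ltnW // -kn.
by apply: (@upward_succ v (Ordinal lt_n)) => //; apply: IHn.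
Qed.

(** Every [a_j] is preceded by [b_j] of its own fibre, so among the entry labels only [c_N] can be
    reached from outside. *)
Lemma upward_entry v i x y :
  upward v i -> y.1 = v -> x.1 != y.1 -> nx x = y ->
  exists2 j : 'I_#|T|, j.+1 = #|T| & y = c' v j.
Proof.
case: y => u l up_i /= -> {u} xv xE; have := ham_next_edge x.
rewrite xE /tsp_edge /= (negPf xv) orbF => /and3P[_ _].
case: l xE => [j|//|j] xE; last by move=> /eqP jN; exists j.
have [_ ba] := upward_all j up_i.
by move: xv; rewrite (ham_next_inj (etrans xE (esym ba))) eqxx.
Qed.

Lemma ham_entry (T_ge2 : 2 <= #|T|) : exists x, x.1 != (nx x).1.
Proof.
have /card_gt0P[v _] : 0 < #|T| by apply: ltnW.
have /card_gt0P[u] : 0 < #|predC1 v|.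
  by rewrite cardC1; case: #|T| T_ge2 => [|[]].
rewrite inE /= => u_v; pose i := Ordinal (ltnW T_ge2).
have [k p cE] := rot_to (c_all (a v i)).
have : fpath nx (a v i) p.
  have := cycle_next c_uniq; rewrite -(rot_cycle k) cE /= rcons_path.
  by case/andP.
have : a u i \in p.
  have := c_all (a u i); rewrite -(mem_rot k) cE inE.
  by case/predU1P=> // -[uv]; rewrite uv eqxx in u_v.
move=> /(mem_entries (a v i)); rewrite inE /= (negPf u_v) /=.
by case/mapP=> y + _ + => /entries_pred yE /yE[x xy xE]; exists x; rewrite xE.
Qed.

Lemma ham_walk (T_ge2 : 2 <= #|T|) :
  exists s, [/\ s != [::], cycle e s, forall v, v \in s &
    forall v i, upward v i -> count_mem v s <= 1].
Proof.
(* Cutting the cycle at a change of fibre makes [y] itself an entry, so no visit is split between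
   the two ends. *)
have [x] := ham_entry T_ge2; set y := nx x => xy.
have [k p cE] := rot_to (c_all y).
have /andP[nxp /eqP lastE] : fpath nx x (y :: p) && (nx (last y p) == y).
  have := cycle_next c_uniq; rewrite -(rot_cycle k) cE /= rcons_path eqxx.
  by rewrite andbC.
have xE : last y p = x by apply: ham_next_inj.
pose q := entries x (y :: p).
have qE : q = y :: entries y p by rewrite /q /= (negPf xy).
have lastq : last x.1 (map fst q) = x.1 by rewrite last_entries /= xE.
exists (map fst q); split.
- by rewrite qE.
- have -> : cycle e (map fst q) = path e x.1 (map fst q).
    by rewrite (cycle_path x.1) lastq.
  apply: entries_path; apply: sub_path (_ : path (tsp_edge e) x (y :: p)).
    by move=> z t /orP[/and3P[->]|/andP[->]]; rewrite ?orbT.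
  rewrite -xE -[path _ _ _]/(path (tsp_edge e) (last y (y :: p)) (y :: p)).
  by rewrite -(cycle_path y) -cE rot_cycle.
- move=> v; have i := Ordinal (ltnW T_ge2).
  have : a v i \in y :: p by rewrite -cE mem_rot.
  move/(mem_entries x); rewrite inE => /predU1P[/= ->|//].
  by rewrite -{1}lastq qE /= mem_last.
move=> v i up_i; rewrite count_map -size_filter.
have q_uniq : uniq (filter (preim fst (pred1 v)) q).
  rewrite filter_uniq // (subseq_uniq (entries_subseq _ _)) //.
  by rewrite -cE rot_uniq.
(* All entries into an upward fibre are the single vertex [c_N], which a duplicate-free list
   contains at most once. *)
have q_top z t : z \in filter (preim fst (pred1 v)) q ->
    t \in filter (preim fst (pred1 v)) q -> z = t.
  have top r : r \in filter (preim fst (pred1 v)) q ->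
      exists2 j : 'I_#|T|, j.+1 = #|T| & r = c' v j.
    rewrite mem_filter /= => /andP[/eqP rv].
    by case/(entries_pred nxp) => r' r'r r'E; apply: upward_entry up_i _ _ r'E.
  move=> /top[j jN ->] /top[j' j'N ->].
  by congr (_, Lc _); apply/val_inj/succn_inj; rewrite jN.
case: filter q_uniq q_top => [|z [|t r]] //= /andP[+ _] zt.
by rewrite (zt z t) ?inE ?eqxx ?orbT.
Qed.

(** The chosen edges start in distinct fibres, so counting their starting points in the cycle counts
    the vertices [v] whose chosen edge is used. *)
Lemma ham_weight (d : T -> V * V) :
    (forall v, downward_edge v (d v)) ->
  cycle_weight (tsp_weight d) c = #|[set v | nx (d v).1 == (d v).2]|.
Proof.
move=> d_down; rewrite /cycle_weight big_uniq //=.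
have dv v : (d v).1.1 = v by case/and3P: (d_down v) => /eqP.
transitivity #|[set (d v).1 | v in [set v | nx (d v).1 == (d v).2]]|.
  rewrite -[RHS]sum1_card big_mkcond [RHS]big_mkcond /=; apply: eq_bigr => x _.
  rewrite c_all /tsp_weight; congr (if _ then _ else _).
  apply/existsP/imsetP => [[v /eqP vx]|[v + ->]].
    by exists v; rewrite ?inE vx //=.
  by rewrite inE => /eqP vx; exists v; rewrite vx -surjective_pairing.
by rewrite card_in_imset // => v w _ _ vw; rewrite -[v]dv vw dv.
Qed.

Lemma upward_of_not_down v x y :
  downward_edge v (x, y) -> nx x != y -> exists i, upward v i.
Proof.
case: x y => [u l] [w l'] /and3P[/= /eqP-> /eqP-> ll'] /eqP xy.
case: l l' ll' xy => [i|i|i] [j|j|j] //= /eqP<- xy; exists i.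
  exact: upward_of_not_ab.
exact: upward_of_not_bc.
Qed.

End HamiltonianCycles.

Lemma unbounded_ham_cycle_of_tsp (T : finType) (e : rel T) d c :
    symmetric e -> 2 <= #|T| ->
    (forall v, downward_edge v (d v)) -> ham_cycle (tsp_edge e) c ->
  exists k s, unbounded_ham_cycle e k s /\ k <= cycle_weight (tsp_weight d) c.
Proof.
move=> e_sym T_ge2 d_down c_ham.
have [s [s_n0 ss s_all up_s]] := ham_walk c_ham T_ge2.
exists #|[set v | unbounded s v]|, s; split.
  exact: ham_cycle_of_closed_walk.
rewrite (ham_weight c_ham d_down); apply/subset_leq_card/subsetP=> v.
rewrite !inE; apply: contraLR => not_down; rewrite /unbounded -leqNgt.
have := d_down v; rewrite [d v]surjective_pairing => dv.
by have [i] := upward_of_not_down c_ham dv not_down; apply: up_s.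
Qed.

(** * The chain of labels in one fibre *)

Section Labels.

Variable n : nat.
Implicit Types (i j k : 'I_n) (ks : seq 'I_n) (l : label n).

Definition label_index l : 'I_n :=
  match l with La i => i | Lb i => i | Lc i => i end.

(** Steps of the chain a_1, b_1, c_1, a_2, ..., c_N; an upward crossing runs through it in
    reverse. *)
Definition label_step l l' := down_label l l' || link_label l l'.

Definition label_path ks : seq (label n) :=
  flatten [seq [:: La k; Lb k; Lc k] | k <- ks].

Definition consecutive : rel 'I_n := fun i j => i.+1 == j :> nat.

Lemma label_path_step k ks : path consecutive k ks ->
  path label_step (La k) [:: Lb k, Lc k & label_path ks].
Proof.
elim: ks k => [|k' ks IHks] k; rewrite /= /label_step /= !eqxx //=.
case/andP=> kk' /IHks /=; rewrite /label_step /= !eqxx /= => ->.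
by rewrite andbT; apply: kk'.
Qed.

Lemma last_label_path l k ks : last l (label_path (k :: ks)) = Lc (last k ks).
Proof. by elim: ks k l => //= k' ks IHks k l; apply: IHks. Qed.

Lemma count_label_path l ks :
  count_mem l (label_path ks) = count_mem (label_index l) ks.
Proof.
elim: ks => //= k ks IHks; rewrite IHks.
have labelE (l1 l2 : label n) : (l1 == l2) = (label_code l1 == label_code l2).
  by rewrite (can_eq (@label_codeK n)).
by case: l {IHks} => i /=; rewrite !labelE /= /eq_op /= ?addn0 ?add0n.
Qed.

Lemma drop_enum_ord j : drop j (enum 'I_n) = j :: drop j.+1 (enum 'I_n).
Proof. by rewrite (drop_nth j) ?size_enum_ord // nth_ord_enum. Qed.

Lemma enum_ord_consecutive : sorted consecutive (enum 'I_n).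
Proof.
have : sorted (fun a b : nat => a.+1 == b) (iota 0 n).
  by case: n => //= m; elim: m 0 => //= m IHm k; rewrite eqxx IHm.
by rewrite -val_enum_ord sorted_map.
Qed.

Lemma last_enum_ord k : (last k (enum 'I_n)).+1 = n.
Proof.
have n_gt0 : 0 < n by apply: leq_ltn_trans (ltn_ord k).
by rewrite -nth_last size_enum_ord nth_enum_ord ?prednK // ltn_predL.
Qed.

Lemma count_drop_enum_ord m k : count_mem k (drop m (enum 'I_n)) = (m <= k).
Proof.
rewrite count_uniq_mem ?drop_uniq ?enum_uniq //.
rewrite -(mem_map val_inj) map_drop val_enum_ord drop_iota mem_iota add0n.
case: (leqP m k) => //= mk.
by rewrite subnKC ?ltn_ord // ltnW // (leq_ltn_trans mk).
Qed.

End Labels.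

(** * Lifting a closed walk of G to a cycle of H *)

Section BuildCycle.

Variables (T : finType) (e : rel T) (U : pred T).
Notation V := (tsp_vertex T).
Notation N := #|T|.

(** Fibres in [U] are traversed only downwards and all others only upwards, so a cycle for this
    relation avoids the chosen edges outside [U]. *)
Definition oriented_edge : rel V := fun x y =>
  [&& e x.1 y.1, exit_label x.2 & entry_label y.2] || (x.1 == y.1) &&
    (if U x.1 then label_step x.2 y.2 else label_step y.2 x.2).

(* The labels crossed at a visit of [v] preceded by the visits in [q] and
   followed by those in [t]. *)
Definition block (v : T) (q t : seq T) : seq (label N) :=
  if U v then
    let ks := drop (count_mem v q) (enum 'I_N) in
    label_path (if v \in t then take 1 ks else ks)
  else rev (label_path (enum 'I_N)).

(** [q] holds the past visits in reverse order; [block] only reads multiplicities from it. *)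
Fixpoint block_cycle (q t : seq T) : seq V :=
  if t is v :: t' then
    [seq (v, l) : V | l <- block v q t'] ++ block_cycle (v :: q) t'
  else [::].

(** The bound leaves a triple for this visit. A downward block runs from some [a_k] to some [c_j],
    an upward one from [c_N] to [a_1]; these are entry and exit labels. *)
Lemma block_path v q t : count_mem v q < N ->
  exists l0 ls, [/\ block v q t = l0 :: ls, entry_label l0,
    exit_label (last l0 ls) &
    path (fun l l' => if U v then label_step l l' else label_step l' l) l0 ls].
Proof.
move=> lt_q; rewrite /block; case: ifP => _.
  pose k := Ordinal lt_q; rewrite [drop _ _](drop_enum_ord k).
  have := drop_sorted k (enum_ord_consecutive N); rewrite drop_enum_ord /=.
  move: (drop _.+1 _) => ks kks; rewrite take0.
  pose ks' := if v \in t then [::] else ks.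
  have -> : (if v \in t then [:: k] else k :: ks) = k :: ks'.
    by rewrite /ks'; case: ifP.
  have k_ks' : path (@consecutive N) k ks' by rewrite /ks'; case: ifP.
  exists (La k), [:: Lb k, Lc k & label_path ks']; split=> //.
    by have := last_label_path (La k) k ks' => /= ->.
  exact: label_path_step.
pose k0 := Ordinal (leq_ltn_trans (leq0n _) lt_q).
have := enum_ord_consecutive N; have := last_enum_ord k0.
rewrite -[enum _]drop0 [drop 0 _](drop_enum_ord k0) /=.
move: (drop _ _) => ks lastN k0_ks.
have := last_label_path (La k0) k0 ks; have := label_path_step k0_ks.
rewrite -[label_path (k0 :: ks)]/(La k0 :: [:: Lb k0, Lc k0 & label_path ks]).
move: (Lc k0 :: _) => ls k0_ls lastE.
exists (last (La k0) (Lb k0 :: ls)), (rev (belast (La k0) (Lb k0 :: ls))).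
split.
- by rewrite lastI rev_rcons.
- by rewrite [last _ _]lastE /= lastN.
- by rewrite [belast _ _]/= rev_cons last_rcons.
- by rewrite rev_path.
Qed.

Lemma block_cycle_path q t x :
    path e x.1 t -> exit_label x.2 ->
    {in t, forall v, count_mem v q + count_mem v t <= N} ->
  [/\ path oriented_edge x (block_cycle q t),
      (last x (block_cycle q t)).1 = last x.1 t &
      exit_label (last x (block_cycle q t)).2].
Proof.
elim: t q x => //= v t IHt q x /andP[xv vt] x_exit few.
have lt_q : count_mem v q < N.
  have := few v (mem_head _ _); rewrite eqxx add1n addnS.
  by apply: leq_trans; rewrite ltnS leq_addr.
have [l0 [ls [-> l0_entry ls_exit l0_ls]]] := block_path t lt_q.
have lastE : last ((v, l0) : V) [seq (v, l) : V | l <- ls] = (v, last l0 ls).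
  exact: (last_map (fun l => (v, l) : V)).
rewrite last_cat cat_path /= lastE.
have [|||-> -> ->] := IHt (v :: q) (v, last l0 ls) => //=.
  move=> u ut; have := few u; rewrite inE ut orbT => /(_ isT).
  by rewrite addnCA addnA.
split=> //; rewrite andbT {1}/oriented_edge xv x_exit l0_entry /=.
apply: (homo_path (f := pair v : label N -> V)) l0_ls => l l'.
by rewrite /oriented_edge /= eqxx => ->; rewrite orbT.
Qed.

(** Past visits of [v] have used up the triples of index below [count_mem v q]; the remaining visits
    cross each other triple once. Outside [U] the bound 1 forces [count_mem v q] to be 0. *)
Lemma count_block_cycle q t v l :
    {in t, forall u, count_mem u q + count_mem u t <= if U u then N else 1} ->
  count_mem ((v, l) : V) (block_cycle q t)
    = (v \in t) && (count_mem v q <= label_index l).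
Proof.
elim: t q => //= u t IHt q few.
have countE : count_mem ((v, l) : V) [seq (u, l') : V | l' <- block u q t]
    = (u == v) * count_mem l (block u q t).
  rewrite count_map; case: (u =P v) => [->|/eqP/negPf uv].
    by rewrite mul1n; apply: eq_count => l' /=; rewrite xpair_eqE eqxx.
  rewrite mul0n; apply/eqP; rewrite -leqn0 leqNgt -has_count.
  apply/hasPn=> l' _ /=.
  by rewrite xpair_eqE uv.
rewrite count_cat countE IHt => [|w wt]; last first.
  have := few w; rewrite inE wt orbT => /(_ isT).
  by rewrite /= addnCA addnA.
rewrite inE [v == u]eq_sym /=; case: (u =P v) => [uv|_]; last by [].
rewrite -{}uv in countE *; rewrite mul1n /= add1n /block.
have := few u (mem_head _ _); rewrite eqxx add1n addnS.
case: ifP => _ le_q.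
  rewrite count_label_path; case: ifP => ut /=; last first.
    by rewrite count_drop_enum_ord addn0.
  have lt_q : count_mem u q < N by apply: leq_trans le_q; rewrite ltnS leq_addr.
  rewrite [drop _ _](drop_enum_ord (Ordinal lt_q)) take_cons take0 /= addn0.
  (* The current visit takes exactly the triple of index [count_mem u q]; larger indices are left to
     later visits. *)
  rewrite -val_eqE /= [count_mem u q <= _]leq_eqVlt; case: eqP => [->|//].
  by rewrite ltnn.
rewrite count_rev count_label_path.
rewrite -[enum _]drop0 count_drop_enum_ord.
have /andP[/eqP-> /eqP ut] : (count_mem u q == 0) && (count_mem u t == 0).
  by rewrite -addn_eq0 -leqn0.
by have /count_memPn/negPf-> := ut.
Qed.

End BuildCycle.

Lemma tsp_of_closed_walk (T : finType) (e : rel T)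
    (d : T -> tsp_vertex T * tsp_vertex T) s :
    irreflexive e -> (forall v, downward_edge v (d v)) ->
    cycle e s -> (forall v, v \in s) -> (forall v, count_mem v s <= #|T|) ->
    0 < #|T| ->
  exists2 c, ham_cycle (tsp_edge e) c &
    cycle_weight (tsp_weight d) c <= #|[set v | unbounded s v]|.
Proof.
move=> e_irr d_down ss s_all few T_gt0; pose U := unbounded s.
pose c := block_cycle U [::] s.
have count1 x : count_mem x c = 1.
  case: x => v l; rewrite count_block_cycle /= ?s_all // => u _.
  by case: ifP => [_|/negbT]; [apply: few | rewrite /U /unbounded -leqNgt].
have c_all x : x \in c by rewrite -has_pred1 has_count count1.
have c_uniq : uniq c by apply: count_mem_uniq => x; rewrite c_all count1.
have c_cycle : cycle (oriented_edge e U) c.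
  have /card_gt0P[v0 _] := T_gt0.
  have last_s : last (last v0 s) s = last v0 s.
    by case: (s) (s_all v0).
  have c_path x px x_exit :=
    @block_cycle_path _ e U [::] s x px x_exit (fun v _ => few v).
  have s_path : path e (last v0 s) s by rewrite -(cycle_path v0).
  (* An auxiliary start with an exit label: a first run from it shows that [c] ends at an exit in
     the fibre of the last vertex of [s]. A second run, from that end, is the cycle condition. *)
  pose x : tsp_vertex T := (last v0 s, La (Ordinal T_gt0)).
  have [_ cE c_exit] := c_path x s_path isT.
  rewrite (cycle_path x); have [|//] := c_path _ _ c_exit.
  by rewrite cE /= last_s.
have edge_sub : subrel (oriented_edge e U) (tsp_edge e).
  move=> x y /orP[xy|/andP[/eqP xy step]]; rewrite /tsp_edge.
    by rewrite xy.
  rewrite xy eqxx /=; apply/orP; right.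
  by move: step; rewrite /label_step; case: ifP => _ /orP[->|->]; rewrite ?orbT.
have c_ham : ham_cycle (tsp_edge e) c.
  by rewrite /ham_cycle (sub_cycle edge_sub) // c_uniq; apply/forallP.
exists c => //; rewrite (ham_weight c_ham d_down).
apply/subset_leq_card/subsetP=> v; rewrite !inE => /eqP dv.
have := next_cycle c_cycle (c_all (d v).1); rewrite dv /oriented_edge.
have /and3P[/eqP-> /eqP-> down] := d_down v.
(* Irreflexivity excludes an edge of G inside a fibre; for bounded [v] only reversed chain steps
   remain, and no downward edge is one. *)
rewrite e_irr eqxx /= -/(U v); case: ifP => // _.
by move: down; rewrite /label_step; case: (d v).1.2 (d v).2.2 => i [].
Qed.

(** * Equality of the two minima *)

Theorem mainTheorem7 (T : finType) (e : rel T)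
    (e_sym : symmetric e) (e_irr : irreflexive e) (e_conn : connected e)
    (T_ge2 : 2 <= #|T|) :
  exists2 m : nat,
    is_minimum (fun k => exists s : seq T, unbounded_ham_cycle e k s) m &
    forall d : T -> tsp_vertex T * tsp_vertex T,
      (forall v : T, downward_edge v (d v)) ->
      (exists c : seq (tsp_vertex T), ham_cycle (tsp_edge e) c) /\
      is_minimum
        (fun k => exists2 c : seq (tsp_vertex T),
           ham_cycle (tsp_edge e) c & cycle_weight (tsp_weight d) c = k) m.
Proof.
have [m m_min] := ex_is_minimum (ex_unbounded_ham_cycle e_sym e_conn T_ge2).
exists m => // d d_down; have [[s s_ham] m_le] := m_min.
have weight_ge c :
    ham_cycle (tsp_edge e) c -> m <= cycle_weight (tsp_weight d) c.
  move=> c_ham.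
  have [k [s' [s'_ham]]] := unbounded_ham_cycle_of_tsp e_sym T_ge2 d_down c_ham.
  by apply: leq_trans; apply: m_le; exists s'.
have [ss s_all mE] := closed_walk_of_ham_cycle e_sym s_ham.
have [s1 [ss1 s1_all few le1]] := closed_walk_few_visits ss s_all.
have T_gt0 := ltnW T_ge2.
have [c c_ham c_le] :=
  tsp_of_closed_walk e_irr d_down ss1 s1_all few T_gt0.
split; first by exists c.
split; last by move=> k [c1 c1_ham <-]; apply: weight_ge.
exists c => //; apply/eqP; rewrite eqn_leq weight_ge // andbT -mE.
(* Shortening raises no visit count, so a vertex unbounded in [s1] is unbounded in [s]. *)
apply: leq_trans c_le _; apply/subset_leq_card/subsetP=> v; rewrite !inE.
by move=> /leq_trans; apply.
Qed.
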